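(* Let $(\xi_n)_{n\ge 1}$ be a sequence of independent identically distributed random variables taking the values $0,2,3,5$ with probabilities $p_0=p_2=p_3=p_5=\frac14$, and let $\xi=\sum_{n=1}^{\infty}4^{-n}\xi_n$. Then $\xi$ has an absolutely continuous distribution whose spectrum (the minimal closed support) is the Guthrie--Nymann Cantorval $$X=\left\{\sum_{n=1}^{\infty}\frac{\alpha_n}{4^n}:\ (\alpha_n)\in\{0,2,3,5\}^{\mathbb{N}}\right\}.$$
   Context: A random variable has an absolutely continuous distribution if it takes values in any given Borel set of Lebesgue measure zero with probability $0$. The spectrum of a distribution is its topological support, i.e. the smallest closed set of probability $1$. *)

(* Defs.v *)
From HB Require Import structures.
From mathcomp Require Import all_boot all_order all_algebra finmap.
From mathcomp Require Import all_classical all_reals all_analysis.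
From mathcomp Require Import measurable_realfun.

Set Implicit Arguments.
Unset Strict Implicit.
Unset Printing Implicit Defensive.

Import Order.TTheory GRing.Theory Num.Theory.
Import numFieldNormedType.Exports.

Local Open Scope classical_set_scope.
Local Open Scope ring_scope.

Section random_variables.
Context d (T : measurableType d) (R : realType) (P : probability T R).
Local Open Scope ereal_scope.

Definition mutually_independent (X : nat -> {RV P >-> R}) : Prop :=
  forall (J : {fset nat}) (B : nat -> set R),
    (forall i, i \in J -> measurable (B i)) ->
    P (\bigcap_(i in [set` J]) (X i @^-1` B i)) =
    \prod_(i <- J) P (X i @^-1` B i).

(* Laws are compared on Borel sets only: [distribution P X] is a total
   function on [set R], whose values elsewhere are meaningless. *)
Definition identically_distributed (X : nat -> {RV P >-> R}) : Prop :=
  forall (i j : nat) (A : set R), measurable A ->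
    distribution P (X i) A = distribution P (X j) A.

Definition iid (X : nat -> {RV P >-> R}) : Prop :=
  mutually_independent X /\ identically_distributed X.

End random_variables.

Section spectrum.
Context (R : realType).
Local Open Scope ereal_scope.

Definition is_spectrum (mu : probability R R) (S : set R) : Prop :=
  [/\ closed S, mu S = 1 &
      forall F : set R, closed F -> mu F = 1 -> S `<=` F].

End spectrum.

Section quaternary_series.
Context (R : realType).

(* Sequences are indexed from 0: [a n] is the digit of weight 4^-(n+1). *)
Definition quaternary_sum (a : nat -> R) : R :=
  limn (series (fun k => a k / 4 ^+ k.+1)).

Definition digits : set R := [set 0; 2; 3; 5].

Definition guthrie_nymann : set R :=
  [set quaternary_sum a | a in [set a : nat -> R | forall n, digits (a n)]].

End quaternary_series.

Section measurable_limn.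
Context d (T : measurableType d) (R : realType) (S : nat -> T -> R).
Hypothesis measurable_S : forall n, measurable_fun setT (S n).

Let D : set T := [set w | cvgn (S ^~ w)].

Let DE : D = \bigcap_(k in @setT nat) \bigcup_(N in @setT nat)
  \bigcap_(n in [set n | (N <= n)%N]) \bigcap_(m in [set m | (N <= m)%N])
   [set w | `|S n w - S m w| < k.+1%:R^-1].
Proof.
apply/seteqP; split=> w /=.
  move=> /cauchy_cvgP /cauchy_ballP h k _.
  have k0 : 0 < k.+1%:R^-1 :> R by rewrite invr_gt0.
  have [[A B] /= [[a _ aA] [b _ bB]] AB] := h _ k0.
  exists (maxn a b) => // n /= abn m /= abm.
  apply: (AB (S n w, S m w)); split => /=.
    by apply: aA => /=; rewrite (leq_trans _ abn)// leq_maxl.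
  by apply: bB => /=; rewrite (leq_trans _ abm)// leq_maxr.
move=> h; apply/cauchy_cvgP/cauchy_ballP => e e0.
have [k ke] : exists k, k.+1%:R^-1 < e.
  exists (Num.truncn e^-1); rewrite -[ltRHS]invrK ltf_pV2 ?posrE ?invr_gt0//.
  exact: truncnS_gt.
have [N _ hN] := h k I.
exists ([set r | exists2 n, (N <= n)%N & r = S n w],
        [set r | exists2 n, (N <= n)%N & r = S n w]).
  by split; exists N => // n /= Nn; exists n.
move=> [x y] /= [[n Nn ->] [m Nm ->]]; rewrite /ball /=.
exact: lt_trans (hN n Nn m Nm) ke.
Qed.

Let measurable_D : measurable D.
Proof.
rewrite DE; apply: bigcap_measurable => // k _.
apply: bigcup_measurable => N _.
apply: bigcap_measurable; first by exists N => /=.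
move=> n _; apply: bigcap_measurable; first by exists N => /=.
move=> m _; rewrite -[X in measurable X]setTI.
have mf : measurable_fun setT (fun w => `|S n w - S m w|).
  apply: measurableT_comp => //.
  exact: measurable_funB.
by have := mf measurableT _ (measurable_itv `]-oo, (k.+1%:R^-1 : R)[);
  rewrite set_itvE.
Qed.

Lemma measurable_limn : measurable_fun setT (fun w => limn (S ^~ w)).
Proof.
rewrite -(setUv D); apply/measurable_funU => //; first exact: measurableC.
split.
- apply: (@measurable_fun_cvg _ _ _ D S) => [n|w Dw].
    exact: measurable_funTS.
  exact: Dw.
- apply: (@eq_measurable_fun _ _ _ _ _ (cst point)).
    by move=> w; rewrite inE => nDw; exact/esym/dvgP.
  exact: measurable_cst.
Qed.

End measurable_limn.

Section quaternary_random_series.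
Context d (T : measurableType d) (R : realType) (P : probability T R).
Context (X : nat -> {RV P >-> R}).

(* At the points where the series diverges, [limn] takes a default value. *)
Definition random_quaternary_sum (w : T) : R := quaternary_sum (X ^~ w).

Lemma measurable_random_quaternary_sum :
  measurable_fun setT random_quaternary_sum.
Proof.
apply: measurable_limn => n; rewrite /series /=.
by apply: measurable_sum => k; apply: measurable_funM.
Qed.

HB.instance Definition _ := @isMeasurableFun.Build _ _ _ _
  random_quaternary_sum measurable_random_quaternary_sum.

End quaternary_random_series.

(* Main.v *)
Require Import Defs.
From mathcomp Require Import all_boot all_order all_algebra.
From mathcomp Require Import finmap.
From mathcomp Require Import all_classical all_reals all_analysis.
From mathcomp Require Import measurable_realfun zify ring lra.

Set Implicit Arguments.
Unset Strict Implicit.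
Unset Printing Implicit Defensive.

Import Order.TTheory GRing.Theory Num.Theory.
Import numFieldNormedType.Exports.

Local Open Scope classical_set_scope.
Local Open Scope ring_scope.

(* The digits 0, 2, 3, 5 form a complete residue system modulo 4. Hence the
   integer [4^n S_n], where [S_n] is the n-th partial sum, determines the first
   n digits, so each of its values has probability at most 4^-n. As the tail of
   the series is at most (5/3) 4^-n, an interval of length L has probability at
   most L + O(4^-n) for every n: the law is dominated by Lebesgue measure.
   The set X of the values of the series is closed because its closure
   satisfies cl X = U_d (d + cl X) / 4 and is bounded, so that each of its
   points can be expanded digit by digit. It carries the law, and every
   neighbourhood of a point of X contains the image of a cylinder of
   probability 4^-n > 0, which gives minimality. *)

(** * Series in powers of 1/4 with digits 0, 2, 3, 5 *)

Section quaternary_expansions.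
Context {R : realType}.
Implicit Types (a b : nat -> R) (n : nat).

Definition partial_sum a n : R := series (fun k => a k / 4 ^+ k.+1) n.

Definition numerator a n : R := 4 ^+ n * partial_sum a n.

Lemma partial_sumS a n : partial_sum a n.+1 = partial_sum a n + a n / 4 ^+ n.+1.
Proof. by rewrite /partial_sum /series /= big_nat_recr. Qed.

Lemma partial_sum0 a : partial_sum a 0 = 0.
Proof. by rewrite /partial_sum /series /= big_nil. Qed.

Lemma eq_partial_sum a b n : (forall k, (k < n)%N -> a k = b k) ->
  partial_sum a n = partial_sum b n.
Proof.
move=> ab; rewrite /partial_sum /series /=.
by apply: eq_big_nat => k /andP[_ kn]; rewrite ab.
Qed.

Lemma partial_sum_shift a n :
  partial_sum a n.+1 = (a 0%N + partial_sum (fun k => a k.+1) n) / 4.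
Proof.
elim: n => [|n IH].
  by rewrite partial_sumS !partial_sum0 expr1 add0r addr0.
rewrite partial_sumS IH partial_sumS !exprS.
have : (4 ^+ n : R) != 0 by rewrite expf_neq0.
by move=> ?; field.
Qed.

Lemma numeratorS a n : numerator a n.+1 = 4 * numerator a n + a n.
Proof.
rewrite /numerator partial_sumS exprS.
have : (4 ^+ n : R) != 0 by rewrite expf_neq0.
by move=> ?; field.
Qed.

Lemma digits_ge0 (x : R) : digits x -> 0 <= x.
Proof. by case=> [[[|]|]|] /= ->. Qed.

Lemma digits_le5 (x : R) : digits x -> x <= 5.
Proof. by case=> [[[|]|]|] /= ->; rewrite ?ler_nat. Qed.

Lemma digits_nat (x : R) : digits x ->
  exists2 d : nat, x = d%:R & d \in [:: 0; 2; 3; 5]%N.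
Proof.
by case=> [[[|]|]|] /= ->; [exists 0%N|exists 2%N|exists 3%N|exists 5%N].
Qed.

Lemma numerator_nat a n : (forall k, digits (a k)) ->
  exists m : nat, numerator a n = m%:R.
Proof.
move=> da; elim: n => [|n [m IH]].
  by exists 0%N; rewrite /numerator partial_sum0 mulr0.
have [d ad _] := digits_nat (da n).
by exists (4 * m + d)%N; rewrite numeratorS IH ad natrD natrM.
Qed.

(** Distinct digits are incongruent modulo 4, so the residue of the numerator gives its last digit;
    the quotient is the previous numerator, to which induction applies. *)
Lemma numerator_inj a b n : (forall k, digits (a k)) ->
  (forall k, digits (b k)) -> numerator a n = numerator b n ->
  forall k, (k < n)%N -> a k = b k.
Proof.
move=> da db; elim: n => [//|n IH]; rewrite !numeratorS.
have [i ia] := numerator_nat n da; have [j jb] := numerator_nat n db.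
have [c ac c4] := digits_nat (da n); have [d bd d4] := digits_nat (db n).
rewrite ia jb ac bd -!natrM -!natrD => /eqP; rewrite eqr_nat => /eqP ijcd.
have [ij cd] : i = j /\ c = d.
  by move: c4 d4 ijcd; rewrite !inE => /or4P[] /eqP -> /or4P[] /eqP ->; lia.
move=> k; rewrite ltnS leq_eqVlt => /predU1P[->|kn].
  by rewrite ac bd cd.
by apply: IH => //; rewrite ia jb ij.
Qed.

Let exp4_gt0 n : 0 < (4 ^+ n)^-1 :> R.
Proof. by rewrite invr_gt0 exprn_gt0. Qed.

Lemma partial_sum_nondecreasing a : (forall k, digits (a k)) ->
  {homo partial_sum a : m n / (m <= n)%N >-> m <= n}.
Proof.
move=> da; apply/nondecreasing_seqP => n; rewrite partial_sumS lerDl.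
by rewrite mulr_ge0 ?(digits_ge0 (da n)) ?ltW.
Qed.

(** The partial sum completed by the largest possible tail, all of whose digits are 5: the sum of 5
    / 4^k over k > n is (5/3) / 4^n. *)
Let upper a n : R := partial_sum a n + 5 / 3 / 4 ^+ n.

Let upper_nonincreasing a : (forall k, digits (a k)) ->
  {homo upper a : m n / (m <= n)%N >-> n <= m}.
Proof.
move=> da; apply/nonincreasing_seqP => n.
rewrite /upper partial_sumS exprS invfM.
have := digits_le5 (da n); have := exp4_gt0 n.
set e := (4 ^+ n)^-1 => ? ?; rewrite -/e.
have : 0 <= (5 - a n) * e by apply: mulr_ge0; [rewrite subr_ge0|exact: ltW].
by lra.
Qed.

Lemma cvg_quaternary_sum a : (forall k, digits (a k)) ->
  partial_sum a @ \oo --> quaternary_sum a.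
Proof.
move=> da; apply: nondecreasing_is_cvgn; first exact: partial_sum_nondecreasing.
exists (5 / 3) => _ [n _ <-].
have : upper a n <= upper a 0 by exact: upper_nonincreasing.
rewrite /upper partial_sum0 expr0 divr1 add0r; apply: le_trans.
by rewrite lerDl mulr_ge0 ?ltW.
Qed.

Lemma quaternary_sum_ge a n : (forall k, digits (a k)) ->
  partial_sum a n <= quaternary_sum a.
Proof.
move=> da; apply: nondecreasing_cvgn_le; first exact: partial_sum_nondecreasing.
by apply/cvg_ex; exists (quaternary_sum a); exact: cvg_quaternary_sum.
Qed.

Lemma cvg_div_exp4 (c : R) : (c / 4 ^+ n) @[n --> \oo] --> (0 : R).
Proof.
rewrite -(mulr0 c); apply: cvgMr.
under eq_fun do rewrite -exprVn.
by apply: cvg_expr; rewrite ger0_norm ?invr_ge0// invf_lt1// ltr1n.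
Qed.

Lemma quaternary_sum_le a n : (forall k, digits (a k)) ->
  quaternary_sum a <= partial_sum a n + 5 / 3 / 4 ^+ n.
Proof.
move=> da.
have cu : upper a @ \oo --> quaternary_sum a.
  rewrite -[quaternary_sum a]addr0.
  by apply: cvgD; [exact: cvg_quaternary_sum|exact: cvg_div_exp4].
rewrite -(cvg_lim _ cu)//; apply: nonincreasing_cvgn_ge.
  exact: upper_nonincreasing.
by apply/cvg_ex; exists (quaternary_sum a).
Qed.

(** This is the self-similarity of the Cantorval: it is the union of the sets (d + X) / 4 over the
    digits d. *)
Lemma quaternary_sum_shift a : (forall k, digits (a k)) ->
  quaternary_sum a = (a 0%N + quaternary_sum (fun k => a k.+1)) / 4.
Proof.
move=> da; apply: (@cvg_unique _ _ (partial_sum a n.+1 @[n --> \oo])) => //.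
  by have := cvg_quaternary_sum da; rewrite -cvg_shiftS.
rewrite (_ : (fun n => _) = fun n =>
  (a 0%N + partial_sum (fun k => a k.+1) n) / 4); last first.
  by apply/funext => n; exact: partial_sum_shift.
apply: cvgMl; apply: cvgD; first exact: cvg_cst.
exact: cvg_quaternary_sum.
Qed.

End quaternary_expansions.

(** * Closedness of the Cantorval *)

Section guthrie_nymann_closed.
Context {R : realType}.
Let X := @guthrie_nymann R.

Lemma guthrie_nymann_itv : X `<=` `[0, 5 / 3].
Proof.
move=> _ [a da <-]; rewrite /= in_itv /=.
have := quaternary_sum_ge 0 da; have := quaternary_sum_le 0 da.
by rewrite partial_sum0 expr0 divr1 add0r => -> ->.
Qed.

(** The splitting of X by first digit passes to the closure, because a finite union of closed sets
    is closed. *)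
Lemma closure_guthrie_nymann_step (x : R) : closure X x ->
  exists2 d : R, digits d & closure X (4 * x - d).
Proof.
pose f (d x : R) := 4 * x - d.
have cf d : closed (f d @^-1` closure X).
  apply: preimage_closed; last exact: closed_closure.
  move=> y _; apply: cvgB; last exact: cvg_cst.
  by apply: cvgMr; exact: cvg_id.
have XF : X `<=` f 0 @^-1` closure X `|` f 2 @^-1` closure X
    `|` f 3 @^-1` closure X `|` f 5 @^-1` closure X.
  move=> _ [a da <-].
  have Xa : closure X (f (a 0%N) (quaternary_sum a)).
    apply: subset_closure; exists (fun k => a k.+1).
      by move=> k; exact: da.
    by rewrite /f (quaternary_sum_shift da); field.
  by case: (da 0%N) Xa => [[[|]|]|] /= ->; tauto.
have clF := closedU (closedU (closedU (cf 0) (cf 2)) (cf 3)) (cf 5).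
move=> /(closure_subset XF); rewrite -((closure_id _).1 clF).
by case=> [[[|]|]|] ?; [exists 0|exists 2|exists 3|exists 5] => //;
  rewrite /digits /=; tauto.
Qed.

Lemma closed_guthrie_nymann : closed X.
Proof.
have X53 : closure X `<=` `[0, 5 / 3].
  rewrite [X in _ `<=` X](closure_id _).1; last exact: interval_closed.
  exact: closure_subset guthrie_nymann_itv.
move=> x cx.
(* [g] picks a first digit; outside the closure its value is arbitrary. *)
have /choice[g gP] : forall y, exists d, closure X y ->
    digits d /\ closure X (4 * y - d).
  move=> y; have [/closure_guthrie_nymann_step[d]|] := pselect (closure X y).
    by exists d.
  by exists 0.
(* The n-th remainder of [x], that is 4^n times what is left after n digits. *)
pose y n := iter n (fun z => 4 * z - g z) x.
have cy n : closure X (y n).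
  by elim: n => [//|n IH]; rewrite /y iterS; exact: (gP _ IH).2.
pose a n := g (y n).
have da n : digits (a n) by exact: (gP _ (cy n)).1.
have xE n : x - y n / 4 ^+ n = partial_sum a n.
  elim: n => [|n IH]; first by rewrite partial_sum0 expr0 divr1 subrr.
  rewrite partial_sumS -IH /a /y iterS -/(y n) exprS.
  have : (4 ^+ n : R) != 0 by rewrite expf_neq0.
  by move=> ?; field.
exists a => //; apply: (@cvg_unique _ _ (partial_sum a @ \oo)) => //.
  exact: cvg_quaternary_sum.
rewrite -[x]subr0 (_ : partial_sum a = fun n => x - y n / 4 ^+ n); last first.
  by apply/funext => n; rewrite xE.
apply: cvgB; first exact: cvg_cst.
(* All remainders lie in the closure of X, hence in [0, 5/3], so dividing them by 4^n gives a null
   sequence. *)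
apply: (@squeeze_cvgr _ _ _ _ (cst 0) (fun n => 5 / 3 / 4 ^+ n)).
- near=> n; have := X53 _ (cy n); rewrite /= in_itv /= => /andP[y0 y53].
  by rewrite divr_ge0 ?exprn_ge0//= ler_wpM2r// invr_ge0 exprn_ge0.
- exact: cvg_cst.
- exact: cvg_div_exp4.
Unshelve. all: by end_near. Qed.

End guthrie_nymann_closed.

(** * Comparison of a measure with Lebesgue measure *)

Section absolute_continuity_criterion.
Context {R : realType}.
Local Open Scope ereal_scope.

(** Lebesgue measure is the infimum of total lengths of countable covers by half-open intervals, and
    subadditivity bounds [mu A] by each such total. *)
Lemma le_lebesgue_measure (mu : {measure set R -> \bar R}) :
  (forall u v : R, (u <= v)%R -> mu `]u, v]%classic <= (v - u)%:E) ->
  forall A, measurable A -> mu A <= lebesgue_measure A.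
Proof.
move=> muoc A mA; apply: le_ereal_inf_tmp => _ [F [mF AF] <-].
have mFR k : measurable (F k : set R) by exact: sub_sigma_algebra (mF k).
apply: (@le_trans _ _ (\sum_(0 <= k <oo) mu (F k))).
  exact: measure_sigma_subadditive.
apply: lee_nneseries => // k _.
have /ocitvP[->|[[u v] /= uv ->]] := mF k; first by rewrite !measure0.
by rewrite wlength_itv_bnd ?muoc// ltW.
Qed.

End absolute_continuity_criterion.

(** * Inclusions of events up to a null event *)

Section almost_sure.
Context d (T : measurableType d) (R : realType) (P : probability T R).
Local Open Scope ereal_scope.

Lemma le_probability_as (D A B : set T) : measurable D -> measurable A ->
  measurable B -> P D = 1 -> A `&` D `<=` B -> P A <= P B.
Proof.
move=> mD mA mB PD ADB.
have PDC : P (~` D) = 0 by rewrite probability_setC// PD subee.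
rewrite -[leRHS]adde0 -PDC; apply: le_trans (measureU2 _ _ _) => //; last first.
  exact: measurableC.
apply: le_measure; rewrite ?inE//.
  by apply: measurableU => //; exact: measurableC.
move=> w Aw; have [Dw|] := pselect (D w); last by right.
by left; exact: ADB.
Qed.

End almost_sure.

(** * The law of the random series *)

Section random_digits.
Context d (T : measurableType d) (R : realType) (P : probability T R).
Context (X : nat -> {RV P >-> R}).
Hypothesis X_indep : mutually_independent X.
Hypothesis X_law : forall (n : nat) (a : R), digits a ->
  P (X n @^-1` [set a]) = (4^-1)%:E.

Definition cylinder (b : nat -> R) n : set T :=
  [set w | forall k, (k < n)%N -> X k w = b k].

(** The form of a finite intersection to which [mutually_independent] applies. *)
Let cylinderE b n : cylinder b n =
  \bigcap_(k in [set` seq_fset tt (iota 0 n)]) (X k @^-1` [set b k]).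
Proof.
have memJ k : [set` seq_fset tt (iota 0 n)] k = (k < n)%N :> Prop.
  by rewrite /mkset seq_fsetE mem_iota.
apply/seteqP; split=> w h k; first by rewrite memJ; exact: h.
by move=> kn; apply: h; rewrite memJ.
Qed.

Lemma measurable_cylinder b n : measurable (cylinder b n).
Proof.
by rewrite cylinderE; apply: fin_bigcap_measurable => // k _.
Qed.

Lemma probability_cylinder b n : (forall k, digits (b k)) ->
  P (cylinder b n) = (4^-1 ^+ n)%:E.
Proof.
move=> db; rewrite cylinderE X_indep; last by move=> *; exact: measurable_set1.
under eq_bigr do rewrite X_law//.
rewrite (perm_big (iota 0 n)); last first.
  apply: uniq_perm => [||k]; rewrite ?iota_uniq ?fset_uniq//.
  exact: seq_fsetE.
rewrite big_const_seq count_predT size_iota.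
by elim: n => [|n IH]; rewrite ?expr0// iterS IH exprS EFinM.
Qed.

(** The variables are digits only almost surely; on this event the pointwise results on expansions
    apply. *)
Definition digital : set T := [set w | forall k, digits (X k w)].

Let digitalE : digital = \bigcap_k (X k @^-1` @digits R).
Proof. by apply/seteqP; split=> w /= h k => [_|]; exact: h. Qed.

Let measurable_digits : measurable (@digits R).
Proof. by do !apply: measurableU; exact: measurable_set1. Qed.

Lemma measurable_digital : measurable digital.
Proof.
by rewrite digitalE; apply: bigcapT_measurable => k; exact: measurable_funPTI.
Qed.

Let probability_digits k : P (X k @^-1` @digits R) = 1%E.
Proof.
rewrite /digits !preimage_setU !measureU; last first.
all: try by do ?apply: measurableU; apply: measurable_funPTI.
all: try (apply/seteqP; split => // w /=).
- by case=> -[[->|->]|->] /eqP; rewrite ?eqr_nat // eq_sym pnatr_eq0.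
- by case=> -[->|->] /eqP; rewrite ?eqr_nat // eq_sym pnatr_eq0.
- by case=> -> /eqP; rewrite ?eqr_nat // eq_sym pnatr_eq0.
transitivity ((4^-1 + 4^-1 + 4^-1 + 4^-1)%:E : \bar R)%E; last first.
  by congr EFin; field.
rewrite !EFinD; congr (_ + _ + _ + _)%E; apply: X_law;
  by rewrite /digits /=; tauto.
Qed.

Lemma probability_digital : P digital = 1%E.
Proof.
have mX k : measurable (X k @^-1` @digits R) by exact: measurable_funPTI.
have : P (~` digital) = 0%E.
  apply/eqP; rewrite eq_le measure_ge0 andbT digitalE setC_bigcap.
  rewrite (le_trans (measure_sigma_subadditive _ _ _ (@subset_refl _ _)))//.
  - by move=> k; exact: measurableC.
  - by apply: bigcup_measurable => k _; exact: measurableC.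
  - rewrite eseries0// => k _ _.
    by have := probability_setC P (mX k); rewrite probability_digits subee.
rewrite probability_setC; last exact: measurable_digital.
move/eqP.
by rewrite sube_eq ?fin_num_measure// add0e => /eqP.
Qed.

(** By [numerator_inj], the value m fixes the first n digits, so a single cylinder serves as [C]; if
    no digit sequence attains m, the empty set does. *)
Lemma probability_numerator n m : exists C : set T,
  [/\ measurable C, (P C <= (4^-1 ^+ n)%:E)%E &
      forall w, digital w -> numerator (X ^~ w) n = m%:R -> C w].
Proof.
have [[a [da am]]|na] :=
  pselect (exists a : nat -> R,
    (forall k, digits (a k)) /\ numerator a n = m%:R).
  exists (cylinder a n); split; first exact: measurable_cylinder.
    by rewrite probability_cylinder.
  by move=> w dw wm k kn; apply: (numerator_inj dw da _ kn); rewrite am.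
exists set0; split => //; first by rewrite measure0 lee_fin exprn_ge0.
by move=> w dw wm; apply: na; exists (X ^~ w).
Qed.

Let xi : {RV P >-> R} := random_quaternary_sum X.

Lemma distribution_itv_le n (u v : R) : u <= v ->
  (distribution P xi `]u, v]%classic <= (v - u + 11 / 3 / 4 ^+ n)%:E)%E.
Proof.
move=> uv.
have e0 : 0 < 4 ^+ n :> R by rewrite exprn_gt0.
have /choice[C /all_and3[mC PC CP]] := probability_numerator n.
(* A sum in ]u, v] exceeds its n-th partial sum by at most (5/3) / 4^n, so its numerator lies
   between [l] and [h]. *)
pose l := 4 ^+ n * u - 5 / 3; pose h := 4 ^+ n * v.
have lh : l + 5 / 3 <= h by rewrite /l subrK /h ler_pM2l.
(* [K] counts the integers from [m0] to the truncation of [h], both included. Truncation sends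
   negative reals to 0, which loses nothing since numerators are natural numbers. *)
pose m0 := Num.trunc l; pose K := ((Num.trunc h).+1 - m0)%N.
pose F i := C (m0 + i)%N.
have mF : measurable (\big[setU/set0]_(i < K) F i).
  by apply: bigsetU_measurable => i _; exact: mC.
apply: (@le_trans _ _ (P (\big[setU/set0]_(i < K) F i))).
  apply: (le_probability_as measurable_digital _ mF probability_digital).
    by apply: measurable_funPTI; exact: measurable_itv.
  move=> w [/= + dw]; rewrite in_itv /= => /andP[uw wv].
  have [m wm] := numerator_nat n dw.
  have lm : l <= m%:R.
    rewrite -wm /l lerBlDr; have := quaternary_sum_le n dw.
    move/(le_trans (ltW uw)).
    rewrite -[_ <= _](ler_pM2l e0) => /le_trans; apply.
    by rewrite mulrDr lerD2l [leLHS]mulrC mulfVK// gt_eqF.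
  have mh : m%:R <= h.
    rewrite -wm ler_pM2l//; apply: le_trans wv; exact: quaternary_sum_ge.
  have m0m : (m0 <= m)%N.
    rewrite -(ler_nat R); have [l0|l0] := leP 0 l.
      by apply: le_trans lm; rewrite truncn_le.
    by rewrite /m0 (_ : Num.trunc l = 0%N) ?ler0n//; apply/truncn0Pn; lra.
  have mh' : (m <= Num.trunc h)%N by rewrite truncn_ge_nat// (le_trans _ mh).
  rewrite -bigcup_mkord; exists (m - m0)%N => /=.
    by rewrite /K; lia.
  by rewrite /F subnKC//; exact: CP.
apply: le_trans (Boole_inequality P _) _ => [i _|]; first exact: mC.
apply: (@le_trans _ _ (\sum_(i < K) (4^-1 ^+ n)%:E)%E).
  by apply: lee_sum => i _; exact: PC.
rewrite sumEFin lee_fin sumr_const card_ord -[leLHS]mulr_natl exprVn.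
rewrite ler_pdivrMr// mulrDl mulfVK ?gt_eqF//.
(* One unit pays for including both ends, one for rounding [l] down. With the 5/3 in [l] this yields
   the constant 11/3 = 5/3 + 2. *)
have Kle : K%:R <= h - l + 2.
  have hK : 0 <= h -> (Num.trunc h)%:R <= h by rewrite truncn_le.
  have lK : 0 <= l -> l < m0%:R + 1.
    by move=> /truncn_itv/andP[_]; rewrite -natr1.
  have h0 : h < 0 -> Num.trunc h = 0%N.
    by move=> ?; apply/truncn0Pn; lra.
  rewrite /K; have [hm|hm] := leqP m0 (Num.trunc h).+1; last first.
    by rewrite (eqP (ltnW hm : (_ - _ == 0)%N)); lra.
  have m0_ge0 := ler0n R m0.
  rewrite natrB// -natr1; have [/h0 ->|/hK hK'] := ltP h 0; first by lra.
  by have [/lK|] := leP 0 l; lra.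
by rewrite (le_trans Kle)// /h /l; lra.
Qed.

Lemma distribution_le_lebesgue (A : set R) : measurable A ->
  (distribution P xi A <= lebesgue_measure A)%E.
Proof.
apply: le_lebesgue_measure => u v uv.
(* The previous bound holds for every n, so its error term can be made smaller than any [e]. *)
apply/lee_addgt0Pr => e e0.
have : \forall n \near \oo, (11 / 3 / 4 ^+ n : R) < e.
  exact: (cvgr_lt _ (@cvg_div_exp4 R (11 / 3))).
move=> [n _ /(_ n (leqnn n)) /= ne].
by rewrite (le_trans (distribution_itv_le n uv))// -EFinD lee_fin lerD2l ltW.
Qed.

Lemma distribution_guthrie_nymann : distribution P xi (@guthrie_nymann R) = 1%E.
Proof.
have mX : measurable (@guthrie_nymann R).
  by apply: closed_measurable; exact: closed_guthrie_nymann.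
apply/eqP; rewrite eq_le probability_le1//= -probability_digital.
apply: le_measure; rewrite ?inE//.
- exact: measurable_digital.
- exact: measurable_funPTI.
- by move=> w dw; exists (X ^~ w).
Qed.

Lemma guthrie_nymann_minimal (F : set R) : closed F ->
  distribution P xi F = 1%E -> @guthrie_nymann R `<=` F.
Proof.
move=> cF PF _ [b db <-]; apply: contrapT => nFb.
have mF : measurable F by exact: closed_measurable.
have : nbhs (quaternary_sum b) (~` F).
  by apply: open_nbhs_nbhs; split => //; exact: closed_openC.
move=> /nbhs_ballP[e /= e0 be].
(* Two digit expansions that share n digits have sums at most (5/3) / 4^n apart, so for this n the
   cylinder of [b] is almost surely mapped into the ball, hence outside [F]. *)
have : \forall n \near \oo, (5 / 3 / 4 ^+ n : R) < e.
  exact: (cvgr_lt _ (@cvg_div_exp4 R (5 / 3))).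
move=> [n _ /(_ n (leqnn n)) /= ne].
have : (P (cylinder b n) <= P (xi @^-1` (~` F)))%E.
  apply: (le_probability_as measurable_digital _ _ probability_digital).
  - exact: measurable_cylinder.
  - by apply: measurable_funPTI; exact: measurableC.
  move=> w [bw dw]; apply: be; rewrite /ball /=.
  have bwn : partial_sum b n = partial_sum (X ^~ w) n.
    by apply: eq_partial_sum => k kn; rewrite bw.
  have := quaternary_sum_ge n dw; have := quaternary_sum_le n dw.
  have := quaternary_sum_ge n db; have := quaternary_sum_le n db.
  rewrite bwn /xi /= /random_quaternary_sum ltr_distl => *.
  by apply/andP; split; lra.
rewrite preimage_setC probability_setC; last exact: measurable_funPTI.
rewrite [P (xi @^-1` F)]PF subee// probability_cylinder// lee_fin.
by rewrite leNgt exprn_gt0.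
Qed.

End random_digits.

Theorem corollary1 (d : measure_display) (T : measurableType d) (R : realType)
    (P : probability T R) (xi_ : nat -> {RV P >-> R})
    (xi_iid : iid xi_)
    (xi_law : forall (n : nat) (a : R), digits a ->
       P (xi_ n @^-1` [set a]) = (4^-1)%:E) :
  let xi : {RV P >-> R} := random_quaternary_sum xi_ in
  distribution P xi `<< (@lebesgue_measure R) /\
  is_spectrum (distribution P xi) (@guthrie_nymann R).
Proof.
move=> xi; have [indep _] := xi_iid; split; last first.
  split; first exact: closed_guthrie_nymann.
    exact: distribution_guthrie_nymann.
  exact: guthrie_nymann_minimal.
apply/null_content_dominatesP => A mA A0.
apply/eqP; rewrite eq_le measure_ge0 andbT -A0.
exact: distribution_le_lebesgue.
Qed.
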